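(* Let $\mathcal{A}$ be a unital complex Banach $*$-algebra with proper involution, and let $a,b,c\in\mathcal{A}$. Then the following are equivalent: (1) $a$ has a generalized $(b,c)$-EP inverse. (2) There exist $x,y\in\mathcal{A}$ such that $a=x+y$, $x^*y=yx=0$, $x\in\mathcal{A}_{b,c}^{\#}$, $y\in\mathcal{A}^{qnil}$. (3) There exists $x\in\mathcal{A}_{b,c}^{\#}$ such that $x=ax^2$, $(a^*a^2x)^*=a^*a^2x$, $\lim_{n\to\infty}\|a^n-xa^{n+1}\|^{1/n}=0$. (4) $a\in\mathcal{A}^{d}$ and there exists $x\in\mathcal{A}_{b,c}^{\#}$ such that $x=ax^2$, $(a^d)^*a^2x=(a^d)^*a$, $\lim_{n\to\infty}\|a^n-xa^{n+1}\|^{1/n}=0$.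
   Context: An involution on a complex Banach algebra $\mathcal{A}$ is a map $x\mapsto x^*$ with $(x+y)^*=x^*+y^*$, $(\lambda x)^*=\overline{\lambda}x^*$, $(xy)^*=y^*x^*$, $(x^* )^*=x$; it is proper if $x^*x=0$ implies $x=0$. Group inverse: $a\in\mathcal{A}^{\#}$ if there is $x$ with $ax^2=x$, $ax=xa$, $xa^2=a$; it is unique, denoted $a^{\#}$. $(b,c)$-inverse: $a$ has a $(b,c)$-inverse if there is $x$ with $xab=b$, $cax=c$, $x\in b\mathcal{A}x\cap x\mathcal{A}c$; it is unique, denoted $a^{(b,c)}$. $(b,c)$-EP inverse: $\mathcal{A}_{b,c}^{\#}$ is the set of $a\in\mathcal{A}^{\#}$ such that $a^{(b,c)}$ exists and $a^{\#}=a^{(b,c)}$. Generalized group inverse: $a\in\mathcal{A}^{\mathrm{gg}}$ if there is $x$ with $x=ax^2$, $(a^*a^2x)^*=a^*a^2x$, $\lim_{n\to\infty}\|a^n-xa^{n+1}\|^{1/n}=0$; it is unique, denoted $a^{\mathrm{gg}}$. $a$ has a generalized $(b,c)$-EP inverse if $a\in\mathcal{A}^{\mathrm{gg}}$, $a^{(b,c)}$ exists and $a^{\mathrm{gg}}=a^{(b,c)}$. $\mathcal{A}^{qnil}=\{x\in\mathcal{A}:\lim_{n\to\infty}\|x^n\|^{1/n}=0\}$. g-Drazin inverse: $a\in\mathcal{A}^{d}$ if there is $x$ with $ax^2=x$, $ax=xa$, $a-a^2x\in\mathcal{A}^{qnil}$; it is unique, denoted $a^d$. *)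

(* Defs.v *)
From HB Require Import structures.
From mathcomp Require Import all_boot all_order all_algebra.
From mathcomp Require Import complex.
From mathcomp Require Import all_classical all_reals all_analysis.

Set Implicit Arguments.
Unset Strict Implicit.
Unset Printing Implicit Defensive.

Import Order.TTheory GRing.Theory Num.Theory.
Import numFieldNormedType.Exports.

Local Open Scope classical_set_scope.
Local Open Scope ring_scope.

(* MathComp has no structure joining normed modules and (noncommutative) rings,
   and Hierarchy-Builder refuses to add one: the only declared join of the two
   is numDomainType.  A Banach algebra is hence a complete normed module with a
   bundled multiplication, whose carrier then receives its algebra instance.
   No normalization of `|1| is required. *)
Record banachAlgType (C : numClosedFieldType) := BanachAlgType {
  ba_module : completeNormedModType C;
  ba_one : ba_module;
  ba_mul : ba_module -> ba_module -> ba_module;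
  ba_mulA : associative ba_mul;
  ba_mul1r : left_id ba_one ba_mul;
  ba_mulr1 : right_id ba_one ba_mul;
  ba_mulDl : left_distributive ba_mul +%R;
  ba_mulDr : right_distributive ba_mul +%R;
  ba_oner_neq0 : ba_one != 0;
  ba_scalerAl : forall (l : C) x y, l *: ba_mul x y = ba_mul (l *: x) y;
  ba_scalerAr : forall (l : C) x y, l *: ba_mul x y = ba_mul x (l *: y);
  ba_normM_le : forall x y, `|ba_mul x y| <= `|x| * `|y|
}.

Definition ba_sort (C : numClosedFieldType) (A : banachAlgType C) : Type :=
  ba_module A.
Coercion ba_sort : banachAlgType >-> Sortclass.

HB.instance Definition _ (C : numClosedFieldType) (A : banachAlgType C) :=
  CompleteNormedModule.copy (ba_sort A) (ba_module A).
HB.instance Definition _ (C : numClosedFieldType) (A : banachAlgType C) :=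
  GRing.Zmodule_isNzRing.Build (ba_sort A) (@ba_mulA C A) (@ba_mul1r C A)
    (@ba_mulr1 C A) (@ba_mulDl C A) (@ba_mulDr C A) (@ba_oner_neq0 C A).
HB.instance Definition _ (C : numClosedFieldType) (A : banachAlgType C) :=
  GRing.Lmodule_isLalgebra.Build C (ba_sort A) (@ba_scalerAl C A).
HB.instance Definition _ (C : numClosedFieldType) (A : banachAlgType C) :=
  GRing.Lalgebra_isAlgebra.Build C (ba_sort A) (@ba_scalerAr C A).

Lemma banach_normM_le (C : numClosedFieldType) (A : banachAlgType C)
    (x y : A) : `|x * y| <= `|x| * `|y|.
Proof. exact: ba_normM_le. Qed.

(* The involution is not required to be isometric, nor even continuous. *)
Record banachStarAlgType (C : numClosedFieldType) := BanachStarAlgType {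
  bsa_alg :> banachAlgType C;
  star : bsa_alg -> bsa_alg;
  starD : forall x y, star (x + y) = star x + star y;
  starZ : forall (l : C) x, star (l *: x) = l^* *: star x;
  starM : forall x y, star (x * y) = star y * star x;
  starK : forall x, star (star x) = x
}.

Definition proper_involution (C : numClosedFieldType)
    (A : banachStarAlgType C) : Prop :=
  forall x : A, star x * x = 0 -> x = 0.

(* Each generalized inverse below comes as the predicate "x is such an inverse
   of a", its solvability, and the inverse itself as a total function, whose
   value is unspecified junk (here 0) when there is no inverse. *)

Definition is_group_inverse (A : nzRingType) (a x : A) : Prop :=
  [/\ a * x ^+ 2 = x, a * x = x * a & x * a ^+ 2 = a].

Definition group_invertible (A : nzRingType) (a : A) : Prop :=
  exists x, is_group_inverse a x.

Definition group_inverse (A : nzRingType) (a : A) : A :=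
  xget 0 [set x | is_group_inverse a x].

Definition is_bc_inverse (A : nzRingType) (b c a x : A) : Prop :=
  [/\ x * a * b = b, c * a * x = c,
      (exists u, x = b * u * x) & (exists v, x = x * v * c)].

Definition bc_invertible (A : nzRingType) (b c a : A) : Prop :=
  exists x, is_bc_inverse b c a x.

Definition bc_inverse (A : nzRingType) (b c a : A) : A :=
  xget 0 [set x | is_bc_inverse b c a x].

Definition bc_EP (A : nzRingType) (b c a : A) : Prop :=
  [/\ group_invertible a, bc_invertible b c a
    & group_inverse a = bc_inverse b c a].

(* Norms over C take their values in C; on nonnegative elements n.-root is the
   nonnegative n-th root. *)
Definition norm_root_cvg0 (C : numClosedFieldType) (A : banachAlgType C)
    (u : nat -> A) : Prop :=
  n.-root `|u n| @[n --> \oo] --> (0 : C).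

Definition quasinilpotent (C : numClosedFieldType) (A : banachAlgType C)
    (x : A) : Prop :=
  norm_root_cvg0 (fun n => x ^+ n).

Definition is_gdrazin_inverse (C : numClosedFieldType) (A : banachAlgType C)
    (a x : A) : Prop :=
  [/\ a * x ^+ 2 = x, a * x = x * a & quasinilpotent (a - a ^+ 2 * x)].

Definition gdrazin_invertible (C : numClosedFieldType) (A : banachAlgType C)
    (a : A) : Prop :=
  exists x, is_gdrazin_inverse a x.

Definition gdrazin_inverse (C : numClosedFieldType) (A : banachAlgType C)
    (a : A) : A :=
  xget 0 [set x | is_gdrazin_inverse a x].

Definition is_gg_inverse (C : numClosedFieldType) (A : banachStarAlgType C)
    (a x : A) : Prop :=
  [/\ x = a * x ^+ 2,
      star (star a * a ^+ 2 * x) = star a * a ^+ 2 * x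
    & norm_root_cvg0 (fun n => a ^+ n - x * a ^+ n.+1)].

Definition gg_invertible (C : numClosedFieldType) (A : banachStarAlgType C)
    (a : A) : Prop :=
  exists x, is_gg_inverse a x.

Definition gg_inverse (C : numClosedFieldType) (A : banachStarAlgType C)
    (a : A) : A :=
  xget 0 [set x | is_gg_inverse a x].

Definition has_generalized_bc_EP_inverse (C : numClosedFieldType)
    (A : banachStarAlgType C) (b c a : A) : Prop :=
  [/\ gg_invertible a, bc_invertible b c a
    & gg_inverse a = bc_inverse b c a].

(* Main.v *)
Require Import Defs.
From mathcomp Require Import all_boot all_order all_algebra.
From mathcomp Require Import complex.
From mathcomp Require Import all_classical all_reals all_analysis.

(** Write p = a ^+ 2 z, the core of a, when z is a generalized group inverse
    of a.  Everything rests on one splitting: z is a generalized group inverse of a exactly when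
    a = p + y where p has group inverse z, star p * y = 0, y * p = 0 and y is
    quasinilpotent ([gg_inverse_core_split], [core_split_gg_inverse]).

    The analytic content is an absorption principle ([absorption]).  If the
    n-th roots of the norms of a ^+ n - t a ^+ n.+1 tend to 0 and w = a w v,
    then w = a ^+ n w v ^+ n for all n, so w - t a w is a fixed element bounded
    by a superexponentially small sequence times a geometric one: it is 0, and
    t a fixes w.  Applied to w = z and w = a z it yields all the algebraic
    identities of the splitting.  Applied to two generalized group inverses it
    shows that the ranges of their core parts contain each other; both
    remainders are then orthogonal to both cores, and properness of the
    involution forces the cores, hence the inverses, to agree
    ([gg_inverse_uniq]).  Applied to a g-Drazin inverse d it gives
    d = z a d and p = d a p, so that star d * (a - p) = 0 and the
    condition star p * y = 0 of the splitting are equivalent.  A g-Drazin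
    inverse exists because d = z + z d y has a solution, the sum of the series
    z ^+ n.+1 y ^+ n ([sandwich_fixpoint], [gdrazin_of_core]).

    What concerns b and c is algebra: since a z = p z, the element z is the
    (b,c)-inverse of a if and only if it is that of p ([bc_inverse_core]), and,
    z and p being group inverses of each other, if and only if p is the
    (b,c)-inverse of z ([bc_inverse_sym]). *)

Set Implicit Arguments.
Unset Strict Implicit.
Unset Printing Implicit Defensive.

Import Order.TTheory GRing.Theory Num.Theory.
Import numFieldNormedType.Exports.

Local Open Scope classical_set_scope.
Local Open Scope ring_scope.
Local Open Scope complex_scope.

(** * Superexponential decay of sequences *)

(** Replaces roots by powers: the sequence is eventually dominated by every
    geometric sequence. *)
Lemma norm_root_cvg0P (C : numClosedFieldType) (A : banachAlgType C)
    (u : nat -> A) :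
  norm_root_cvg0 u <->
  forall e : C, 0 < e -> \forall n \near \oo, `|u n| <= e ^+ n.
Proof.
split=> [/cvgr0Pnorm_lt u0 e e0|u0].
  have := u0 _ e0; apply: filterS2 (nbhs_infty_gt 0%N) => n n0.
  rewrite ger0_norm ?rootC_ge0// => /ltW ue.
  by rewrite -(rootCK n0 `|u n|) lerXn2r// nnegrE ?rootC_ge0// ltW.
apply/cvgr0Pnorm_lt => e e0; have e20 : 0 < e / 2%:R by rewrite divr_gt0.
have := u0 _ e20; apply: filterS2 (nbhs_infty_gt 0%N) => n n0 ue.
rewrite ger0_norm ?rootC_ge0//.
have /le_lt_trans : n.-root `|u n| <= e / 2%:R.
  rewrite -[leRHS](exprCK n0 (ltW e20)) ler_rootC// ?nnegrE//.
  by rewrite exprn_ge0// ltW.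
by apply; rewrite ltr_pdivrMr// ltr_pMr// ltr1n.
Qed.

(** Nonnegative elements of R[i] are real, so the archimedean property of R
    applies to them. *)
Lemma near_le_exp2 (R : realType) (K : R[i]) :
  0 <= K -> \forall n \near \oo, K <= 2%:R ^+ n.
Proof.
move=> K0; near=> n.
have -> : K = (complex.Re K)%:C.
  by move: K0; case: {+}K => p q; rewrite lecE /= => /andP[/eqP-> _].
rewrite -[2%:R](rmorph_nat (real_complex R)) -rmorphXn lecR ltW//.
by apply: upper_nthrootP; near: n; apply: nbhs_infty_ge.
Unshelve. all: by end_near. Qed.

(** A geometric factor does not spoil superexponential decay; this is what lets
    one forget bounded multipliers and powers of fixed elements. *)
Lemma norm_root_cvg0_dom (R : realType) (A : banachAlgType R[i]) (K M : R[i])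
    (u v : nat -> A) : 0 <= K -> 0 <= M ->
  (\forall n \near \oo, `|v n| <= K * M ^+ n * `|u n|) ->
  norm_root_cvg0 u -> norm_root_cvg0 v.
Proof.
move=> K0 M0 vu /norm_root_cvg0P u0; apply/norm_root_cvg0P => e e0.
have M1 : 0 < M + 1 by rewrite ltr_wpDl.
(* u is compared with this ratio so that M + 1 cancels M, and 2 pays for K. *)
have e'0 : 0 < e / (2%:R * (M + 1)) by rewrite divr_gt0// mulr_gt0.
near=> n.
have vn : `|v n| <= K * M ^+ n * `|u n| by near: n.
have un : `|u n| <= (e / (2%:R * (M + 1))) ^+ n by near: n; apply: u0.
have Kn : K <= 2%:R ^+ n by near: n; apply: near_le_exp2.
have -> : e = 2%:R * ((M + 1) * (e / (2%:R * (M + 1)))).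
  by rewrite mulrA mulrC divfK// gt_eqF// mulr_gt0.
apply: (le_trans vn).
rewrite exprMn [in leRHS]exprMn mulrA ler_pM//.
- by rewrite mulr_ge0// exprn_ge0.
- rewrite ler_pM// ?exprn_ge0// lerXn2r// ?nnegrE//; first exact: ltW.
  by rewrite lerDl.
Unshelve. all: by end_near. Qed.

Lemma norm_root_cvg0_cst (R : realType) (A : banachAlgType R[i]) (x : A) :
  norm_root_cvg0 (fun=> x) -> x = 0.
Proof.
move=> /norm_root_cvg0P/(_ (2%:R^-1))/= x0; apply/eqP; rewrite -normr_eq0.
apply/eqP; apply/eqP; apply: contraT => xn0.
have x_gt0 : 0 < `|x| by rewrite lt_neqAle eq_sym xn0 normr_ge0.
have half0 : 0 < 2%:R^-1 :> R[i] by rewrite invr_gt0.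
have K0 : 0 <= 2%:R / `|x| by rewrite divr_ge0.
have [n [xn]] := filter_ex (filterI (x0 half0) (near_le_exp2 K0)).
rewrite ler_pdivrMr// => nx.
have : 2%:R <= (1 : R[i]).
  apply: (le_trans nx); rewrite exprVn in xn.
  by rewrite mulrC -ler_pdivlMr ?div1r// exprn_gt0.
by rewrite (ler_nat _ 2 1).
Qed.

(** The tails are dominated by those of the geometric series of ratio 1/2, so
    the Cauchy criterion applies. *)
Lemma norm_root_cvg0_series (R : realType) (A : banachAlgType R[i])
    (u : nat -> A) : norm_root_cvg0 u -> cvgn (series (u : nat -> ba_module A)).
Proof.
move=> /norm_root_cvg0P/(_ 2%:R^-1) u0.
have [|N _ uN] := u0 _; first by rewrite invr_gt0.
have tail m n : (N <= m)%N ->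
    `|\sum_(m <= k < n) (u k : ba_module A)| <= 2%:R * 2%:R^-1 ^+ m.
  move=> Nm; have [nm|/ltnW mn] := leqP n m.
    by rewrite big_geq// normr0 mulr_ge0// exprn_ge0// invr_ge0.
  rewrite -(subnKC mn); move: (n - m)%N => {mn n} p.
  suff: `|\sum_(m <= k < m + p) (u k : ba_module A)| <=
      2%:R * 2%:R^-1 ^+ m - 2%:R * 2%:R^-1 ^+ (m + p).
    by move/le_trans; apply; rewrite gerBl mulr_ge0// exprn_ge0// invr_ge0.
  elim: p => [|p IH]; first by rewrite addn0 big_geq// normr0 subrr.
  rewrite addnS big_nat_recr ?leq_addr//=.
  apply: (le_trans (ler_normD _ _)).
  apply: (le_trans (lerD IH (uN _ (leq_trans Nm (leq_addr _ _))))).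
  rewrite exprS mulrA divff ?pnatr_eq0// mul1r
    [2%:R * _ ^+ (m + p)]mulr_natl.
  by rewrite mulr2n opprD addrA subrK.
apply/cauchy_cvgP/cauchy_seriesP => e e0.
have K0 : 0 <= 2%:R / (e / 2%:R) by rewrite divr_ge0// ltW// divr_gt0.
have [M _ MP] := near_le_exp2 K0.
exists ([set m | (maxn N M <= m)%N], setT).
  by split; [exists (maxn N M) | exact: filterT].
move=> [m n] [/= + _]; rewrite geq_max => /andP[Nm Mm].
apply: (le_lt_trans (tail m n Nm)).
have := MP m Mm; rewrite /= ler_pdivrMr ?divr_gt0// => h.
rewrite exprVn ltr_pdivrMr ?exprn_gt0//.
apply: (le_lt_trans h); rewrite mulrC ltr_pM2r ?exprn_gt0//.
by rewrite ltr_pdivrMr// ltr_pMr// ltr1n.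
Qed.

Lemma norm_root_cvg0_mull (R : realType) (A : banachAlgType R[i]) (t : A)
    (u v : nat -> A) :
  (\forall n \near \oo, v n = t * u n) -> norm_root_cvg0 u -> norm_root_cvg0 v.
Proof.
move=> vu; apply: (@norm_root_cvg0_dom _ _ `|t| 1) => //.
by apply: filterS vu => n ->; rewrite expr1n mulr1; apply: banach_normM_le.
Qed.

(** Shifting the index costs a constant factor 2 / e, absorbed by comparing
    with the ratio e / 2 instead of e. *)
Lemma norm_root_cvg0_pred (R : realType) (A : banachAlgType R[i])
    (u : nat -> A) : norm_root_cvg0 u -> norm_root_cvg0 (fun n => u n.-1).
Proof.
move=> /norm_root_cvg0P u0; apply/norm_root_cvg0P => e e0.
have e20 : 0 < e / 2%:R by rewrite divr_gt0.
have K0 : 0 <= (e / 2%:R)^-1 by rewrite invr_ge0 ltW.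
have [N _ uN] := u0 _ e20; near=> n.
have n0 : (0 < n)%N by near: n; apply: nbhs_infty_gt.
have Nn : (N <= n.-1)%N.
  by rewrite -ltnS prednK//; near: n; apply: nbhs_infty_gt.
have Kn : (e / 2%:R)^-1 <= 2%:R ^+ n by near: n; apply: near_le_exp2.
apply: (le_trans (uN _ Nn)).
have -> : (e / 2%:R) ^+ n.-1 = (e / 2%:R)^-1 * (e / 2%:R) ^+ n.
  by rewrite -[in RHS](prednK n0) exprS mulKf// gt_eqF.
have -> : e ^+ n = 2%:R ^+ n * (e / 2%:R) ^+ n.
  by rewrite -exprMn mulrC divfK// pnatr_eq0.
by rewrite ler_wpM2r// exprn_ge0// ltW.
Unshelve. all: by end_near. Qed.

(** * Consequences of decay in a Banach algebra *)

(** The solution is the sum of the series z ^+ n.+1 y ^+ n, whose partial sums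
    are the iterates of d |-> z + z d y started at 0. *)
Lemma sandwich_fixpoint (R : realType) (A : banachAlgType R[i]) (z y : A) :
  quasinilpotent y -> exists d : A, d = z + z * d * y.
Proof.
move=> qy; pose u n : A := z ^+ n.+1 * y ^+ n.
have zXn n : `|z ^+ n.+1| <= `|z| * `|z| ^+ n.
  elim: n => [|n IH]; first by rewrite expr1 expr0 mulr1.
  rewrite exprS [`|z| ^+ _]exprS; apply: (le_trans (banach_normM_le _ _)).
  by rewrite ler_wpM2l.
have /norm_root_cvg0_series/cvg_ex[/= d ud] : norm_root_cvg0 u.
  apply: (@norm_root_cvg0_dom _ _ `|z| `|z|) qy => //.
  apply: nearW => n; apply: (le_trans (banach_normM_le _ _)).
  by rewrite ler_wpM2r.
exists (d : A).
pose S n : A := \sum_(0 <= k < n) u k.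
have SS n : S n.+1 = z + z * S n * y.
  rewrite /S big_nat_recl// {1}/u expr0 mulr1 expr1; congr (_ + _).
  rewrite mulr_sumr mulr_suml; apply: eq_bigr => k _.
  by rewrite /u exprS [y ^+ k.+1]exprSr !mulrA.
have S_d : S @ \oo --> (d : ba_module A) by [].
have S_d1 : (fun n => S n.+1) @ \oo --> (d : ba_module A).
  by rewrite (cvg_shiftS (S : nat -> ba_module A)).
apply: (cvg_unique (@norm_hausdorff _ (ba_module A)) S_d1).
apply/cvgrPdist_lt => e e0.
have K0 : 0 < `|z| * `|y| + 1 by rewrite ltr_wpDl// mulr_ge0.
have /cvgrPdist_lt/(_ (e / (`|z| * `|y| + 1))) := S_d.
rewrite divr_gt0// => /(_ isT); apply: filterS => n.
rewrite ltr_pdivlMr// => dSn; rewrite SS.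
(* The limit may be taken inside the product: multiplication is Lipschitz. *)
have -> : z + z * (d : A) * y - (z + z * S n * y) = z * ((d : A) - S n) * y.
  by rewrite opprD addrACA subrr add0r mulrBr mulrBl.
apply: le_lt_trans dSn.
apply: (le_trans (banach_normM_le _ _)).
apply: (@le_trans _ _ (`|z| * `|(d : A) - S n| * `|y|)).
  by rewrite ler_wpM2r// banach_normM_le.
rewrite mulrAC mulrC ler_wpM2l//.
by rewrite lerDl.
Qed.

(** Iterating the hypothesis gives w = a ^+ n w v ^+ n, so that w - t a w is
    (a ^+ n - t a ^+ n.+1) w v ^+ n for every n: a constant that decays. *)
Lemma absorption (R : realType) (A : banachAlgType R[i]) (a t w v : A) :
  norm_root_cvg0 (fun n => a ^+ n - t * a ^+ n.+1) ->
  w = a * w * v -> t * a * w = w.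
Proof.
move=> ta wE; apply/esym/eqP; rewrite -subr_eq0; apply/eqP.
have wX n : w = a ^+ n * w * v ^+ n.
  elim: n => [|n IH]; first by rewrite !expr0 mul1r mulr1.
  by rewrite {1}IH {1}wE exprSr exprS !mulrA.
have wvX n : `|w * v ^+ n| <= `|w| * `|v| ^+ n.
  elim: n => [|n IH]; first by rewrite !expr0 !mulr1.
  rewrite exprSr mulrA; apply: (le_trans (banach_normM_le _ _)).
  by rewrite exprSr mulrA ler_wpM2r.
apply: norm_root_cvg0_cst; apply: (@norm_root_cvg0_dom _ _ `|w| `|v|) ta => //.
apply: nearW => n.
have -> : w - t * a * w = (a ^+ n - t * a ^+ n.+1) * (w * v ^+ n).
  rewrite mulrBl exprS !mulrA -wX; congr (_ - _).
  by rewrite {1}(wX n) !mulrA.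
by apply: (le_trans (banach_normM_le _ _)); rewrite mulrC ler_wpM2r.
Qed.

(** * Group inverses and (b,c)-inverses in rings *)

Section GeneralizedInversesInRings.
Variable A : nzRingType.
Implicit Types a b c e x y z : A.

Lemma expr_absorb e a n : e * a * e = e * a -> (e * a) ^+ n.+1 = e * a ^+ n.+1.
Proof.
move=> eae; elim: n => [|n IH]; first by rewrite !expr1.
by rewrite exprS IH mulrA eae -mulrA -exprS.
Qed.

Lemma group_inverse_sym a x : is_group_inverse a x -> is_group_inverse x a.
Proof.
by move=> [ax2 ax xa2]; split.
Qed.

(** Both inverses equal x a y. *)
Lemma group_inverse_uniq a x y :
  is_group_inverse a x -> is_group_inverse a y -> x = y.
Proof.
move=> [ax2 ax xa2] [ay2 ay ya2].
have xxa : x * x * a = x by rewrite -mulrA -ax mulrA -ax -mulrA -expr2.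
have aay : a * a * y = a by rewrite -mulrA ay mulrA ay -mulrA -expr2.
transitivity (x * a * y).
  by rewrite -{2}xxa -!mulrA (mulrA a) aay mulrA xxa.
by rewrite -{1}ay2 expr2 !mulrA -(mulrA x) -expr2 xa2 -mulrA -expr2.
Qed.

Lemma group_inverseE a x : is_group_inverse a x -> group_inverse a = x.
Proof.
move=> ax; apply: xget_unique => // y ay.
exact: group_inverse_uniq ay ax.
Qed.

(** Both inverses equal y a x: x begins with b, which y a fixes, and y ends with
    c, which a x fixes. *)
Lemma bc_inverse_uniq b c a x y :
  is_bc_inverse b c a x -> is_bc_inverse b c a y -> x = y.
Proof.
move=> [_ cax [u xE] _] [yab _ _ [v yE]].
have yax : y * a * x = x by rewrite {1}xE !mulrA yab -xE.
by rewrite -yax {1}yE -!mulrA (mulrA c) cax mulrA -yE.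
Qed.

Lemma bc_inverseE b c a x : is_bc_inverse b c a x -> bc_inverse b c a = x.
Proof.
move=> ax; apply: xget_unique => // y ay.
exact: bc_inverse_uniq ay ax.
Qed.

(** Trades the chosen inverses for a common witness. *)
Lemma bc_EPP b c a :
  bc_EP b c a <-> exists x, is_group_inverse a x /\ is_bc_inverse b c a x.
Proof.
split=> [[/xgetPex ga /xgetPex ba E]|[x [gx bx]]].
  exists (group_inverse a); split; first exact: ga.
  by rewrite E; apply: ba.
by split; [exists x | exists x | rewrite (group_inverseE gx) (bc_inverseE bx)].
Qed.

(** In an EP pair the two elements play symmetric roles: a and x have the same
    left and right ideals, because they are group inverses of each other. *)
Lemma bc_inverse_sym b c a x :
  is_group_inverse a x -> is_bc_inverse b c a x -> is_bc_inverse b c x a.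
Proof.
move=> ga; have [xa2 _ _] := group_inverse_sym ga; move: ga.
move=> [ax2 ax xa2'] [xab cax [u xE] [v xE']]; split.
- by rewrite ax.
- by rewrite -mulrA -ax mulrA.
- by exists u; rewrite -[LHS]xa2 {1}xE -mulrA xa2.
- exists v; have -> : a = a ^+ 2 * x.
    by rewrite expr2 -mulrA ax mulrA ax -mulrA -expr2.
  by rewrite {1}xE' !mulrA.
Qed.

(** Passing from a to its core p does not affect being the (b,c)-inverse: z
    sees a only through the product a z = p z. *)
Lemma bc_inverse_core b c a p z : is_group_inverse p z -> a * z = p * z ->
  is_bc_inverse b c a z <-> is_bc_inverse b c p z.
Proof.
move=> [pz2 pz _] az.
have az2 : a * z ^+ 2 = z by rewrite expr2 mulrA az -mulrA -expr2.
have zpz : z * p * z = z by rewrite -pz -mulrA -expr2.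
have zaz : z * a * z = z by rewrite -mulrA az mulrA.
split=> -[zb cz uz vz]; split=> //.
- by rewrite -pz -az -{1}zb !mulrA -(mulrA a) -expr2 az2.
- by rewrite -mulrA -az mulrA.
- by rewrite -{1}zb !mulrA zaz.
- by rewrite -mulrA az mulrA.
Qed.
End GeneralizedInversesInRings.

(** * Core and quasinilpotent parts *)

Section CoreQuasinilpotentDecomposition.
Variables (R : realType) (A : banachAlgType R[i]).
Implicit Types a d p z : A.

(** The part of the splitting that does not involve the star.  Absorption gives
    z a z = z and z a^2 z = a z, from which the identities follow.  Since
    y * y = y * a and y * z = 0 for y = a - a^2 z, one has
    y ^+ n.+1 = y (a ^+ n - z a ^+ n.+1), so y inherits the decay. *)
Lemma limit_split a z : z = a * z ^+ 2 ->
    norm_root_cvg0 (fun n => a ^+ n - z * a ^+ n.+1) ->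
  [/\ is_group_inverse (a ^+ 2 * z) z, (a - a ^+ 2 * z) * (a ^+ 2 * z) = 0
    & quasinilpotent (a - a ^+ 2 * z)].
Proof.
move=> zE lim; rewrite expr2 mulrA in zE.
have zaz : z * a * z = z := absorption lim zE.
have zaaz : z * a * a * z = a * z.
  by rewrite -mulrA (absorption lim (v := z))// {1}zE !mulrA.
have zp : z * (a ^+ 2 * z) = a * z by rewrite expr2 !mulrA zaaz.
have pz : a ^+ 2 * z * z = a * z.
  by rewrite expr2 -!mulrA [a * (z * z)]mulrA -zE.
have azp : a * z * (a ^+ 2 * z) = a ^+ 2 * z.
  by rewrite -mulrA zp expr2 mulrA.
have ya0 : (a - a ^+ 2 * z) * (a * z) = 0.
  by rewrite mulrBl -[_ * z * _]mulrA (mulrA z) zaz expr2 mulrA subrr.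
have yp : (a - a ^+ 2 * z) * (a ^+ 2 * z) = 0.
  by rewrite -[X in _ * X]azp mulrA ya0 mul0r.
split=> //.
- split; first by rewrite [z ^+ 2]expr2 mulrA pz -zE.
  + by rewrite pz zp.
  + by rewrite [in LHS]expr2 mulrA zp azp.
have {ya0} yz0 : (a - a ^+ 2 * z) * z = 0 by rewrite {2}zE mulrA ya0 mul0r.
have yX n : (a - a ^+ 2 * z) ^+ n.+1 = (a - a ^+ 2 * z) * a ^+ n.
  elim: n => [|n IH]; first by rewrite expr1 mulr1.
  rewrite exprS IH mulrA [X in X * _](_ : _ = (a - a ^+ 2 * z) * a).
    by rewrite -mulrA -exprS.
  by rewrite mulrBr yp subr0.
apply: (norm_root_cvg0_mull (t := a - a ^+ 2 * z) _ (norm_root_cvg0_pred lim)).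
near=> n.
have n0 : (0 < n)%N by near: n; apply: nbhs_infty_gt.
by rewrite -{1}(prednK n0) yX mulrBr [in RHS]mulrA yz0 mul0r subr0.
Unshelve. all: by end_near. Qed.

(** The inverse is the solution d of d = z + z d y, where y = a - p.  The
    relations y z = 0 and p z d = d give a d = d a = p z + d y, and
    a - a^2 d = (1 - a d) y has the powers (1 - a d) y ^+ n. *)
Lemma gdrazin_of_core a p z : is_group_inverse p z -> (a - p) * p = 0 ->
  quasinilpotent (a - p) -> gdrazin_invertible a.
Proof.
move=> [pz2 pz zp2] yp qy; set y := a - p in yp qy.
have aE : a = p + y by rewrite /y addrC subrK.
have [d dE] := sandwich_fixpoint z qy; exists d.
have yz : y * z = 0 by rewrite -pz2 mulrA yp mul0r.
have yd : y * d = 0 by rewrite dE mulrDr yz add0r !mulrA yz !mul0r.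
have ad_pd : a * d = p * d by rewrite {1}aE mulrDl yd addr0.
have pzd : p * z * d = d.
  by rewrite [in RHS]dE [X in _ * X = _]dE mulrDr !mulrA -(mulrA p z z)
    -expr2 pz2.
have ad : a * d = p * z + d * y.
  by rewrite ad_pd {1}dE mulrDr !mulrA pzd.
have da : d * a = p * z + d * y.
  by rewrite {1}aE mulrDr {1}dE mulrDl -!mulrA yp !mulr0 addr0 pz.
have yad : y * a * d = 0.
  by rewrite -mulrA ad -da mulrA yd mul0r.
have a2d : a - a ^+ 2 * d = (1 - a * d) * y.
  have ppz : p * p * z = p by rewrite -mulrA pz mulrA pz -mulrA -expr2.
  rewrite expr2 -mulrA [in LHS]ad mulrDr !mulrA {2}aE mulrDl mulrDl ppz yp
    mul0r addr0.
  by rewrite opprD addrA -/y [RHS]mulrBl mul1r.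
split.
- by rewrite expr2 mulrA ad mulrDl pzd -mulrA yd mulr0 addr0.
- by rewrite ad da.
rewrite a2d; apply: (norm_root_cvg0_mull (t := 1 - a * d) _ qy).
near=> n.
have n0 : (0 < n)%N by near: n; apply: nbhs_infty_gt.
rewrite -(prednK n0) expr_absorb//.
by rewrite -mulrA mulrBr mulr1 [y * (a * d)]mulrA yad subr0.
Unshelve. all: by end_near. Qed.

(** Makes absorption available for d: a - a^2 d = (1 - d a) a, whose powers are
    (1 - d a) a ^+ n. *)
Lemma gdrazin_limit a d : is_gdrazin_inverse a d ->
  d = a * d ^+ 2 /\ norm_root_cvg0 (fun n => a ^+ n - d * a ^+ n.+1).
Proof.
move=> [dE ad qn]; split=> //.
have Xe : a - a ^+ 2 * d = (1 - d * a) * a.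
  by rewrite mulrBl mul1r -ad expr2 -!mulrA ad.
have eae : (1 - d * a) * a * (1 - d * a) = (1 - d * a) * a.
  rewrite mulrBr mulr1 [X in _ - X](_ : _ = 0) ?subr0//.
  by rewrite -Xe mulrBl expr2 -!mulrA (mulrA d d a) -expr2
    (mulrA a (d ^+ 2)) dE subrr.
apply: (norm_root_cvg0_mull (t := 1) _ qn).
near=> n.
have n0 : (0 < n)%N by near: n; apply: nbhs_infty_gt.
rewrite mul1r Xe -(prednK n0) expr_absorb// mulrBl mul1r.
by rewrite [a ^+ n.-1.+2]exprS mulrA.
Unshelve. all: by end_near. Qed.
End CoreQuasinilpotentDecomposition.

(** * Generalized group inverses *)

Section GeneralizedGroupInverse.
Variables (R : realType) (A : banachStarAlgType R[i]).
Implicit Types a p w x y z : A.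

Lemma star0 : star (0 : A) = 0.
Proof. by apply: (addIr (star (0 : A))); rewrite -starD !add0r. Qed.

Lemma starN x : star (- x) = - star x.
Proof. by apply/eqP; rewrite -addr_eq0 -starD addNr star0. Qed.

Lemma starB x y : star (x - y) = star x - star y.
Proof. by rewrite starD starN. Qed.

Lemma star_mul_eq0 x y : star x * y = 0 -> star y * x = 0.
Proof. by move=> xy; rewrite -[star y * x]starK starM starK xy star0. Qed.

(** The inverse z of the core is a parameter, so that the relation links a with
    both its core and its generalized group inverse. *)
Definition core_quasinilpotent_split a p z : Prop :=
  [/\ is_group_inverse p z, star p * (a - p) = 0, (a - p) * p = 0
    & quasinilpotent (a - p)].

Lemma core_split_mulr a p z : core_quasinilpotent_split a p z -> a * z = p * z.
Proof.
move=> [[pz2 pz _] _ yp _]; apply/eqP; rewrite -subr_eq0 -mulrBl.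
by rewrite -pz2 mulrA yp mul0r.
Qed.

(** By orthogonality star a * p reduces to star p * p. *)
Lemma selfadjoint_core a p : star p * (a - p) = 0 ->
  star (star a * p) = star a * p.
Proof.
move=> py; have yp := star_mul_eq0 py.
move: py yp; rewrite starB mulrBl mulrBr => /eqP; rewrite subr_eq0 => /eqP py.
move=> /eqP; rewrite subr_eq0 => /eqP yp.
by rewrite starM starK py yp.
Qed.

Lemma core_splitE a p z : core_quasinilpotent_split a p z -> p = a ^+ 2 * z.
Proof.
move=> S; have az := core_split_mulr S; move: S => [[_ pz zp2] _ _ _].
by rewrite expr2 -mulrA az pz mulrA az pz -mulrA -expr2.
Qed.

(** The element 1 - z a annihilates p, and y a = y y, so that
    (1 - z a) a ^+ n = (1 - z a) y ^+ n with y = a - p quasinilpotent. *)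
Lemma core_split_gg_inverse a p z :
  core_quasinilpotent_split a p z -> is_gg_inverse a z.
Proof.
move=> S; have az := core_split_mulr S; have pE := core_splitE S.
move: S => [[pz2 pz zp2] py yp qy].
split; first by rewrite expr2 mulrA az -mulrA -expr2.
  by rewrite -mulrA -pE selfadjoint_core.
have ep : (1 - z * a) * p = 0.
  have -> : a = p + (a - p) by rewrite addrC subrK.
  by rewrite mulrBl mul1r -mulrA mulrDl yp addr0 -expr2 zp2 subrr.
have ea : (1 - z * a) * a = (1 - z * a) * (a - p).
  by rewrite mulrBr ep subr0.
have ya : (a - p) * a = (a - p) * (a - p) by rewrite [RHS]mulrBr yp subr0.
have eX n : (1 - z * a) * a ^+ n.+1 = (1 - z * a) * (a - p) ^+ n.+1.
  elim: n => [|n IH]; first by rewrite !expr1.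
  rewrite exprSr mulrA IH -mulrA; congr (_ * _).
  by rewrite exprSr -mulrA ya mulrA -!exprSr.
apply: (norm_root_cvg0_mull (t := 1 - z * a) _ qy).
near=> n.
have n0 : (0 < n)%N by near: n; apply: nbhs_infty_gt.
by rewrite -(prednK n0) -eX mulrBl mul1r -mulrA -exprS.
Unshelve. all: by end_near. Qed.

(** As p = a (a z) and p = p (a z), the self-adjointness of star a * p gives
    star p * p = star p * a * (a z) = star a * p * (a z) = star a * p
    = star p * a. *)
Lemma gg_inverse_core_split a z :
  is_gg_inverse a z -> core_quasinilpotent_split a (a ^+ 2 * z) z.
Proof.
move=> [zE sa lim]; have [gp yp qy] := limit_split zE lim.
split=> //.
have zaz : z * a * z = z.
  by apply: (absorption (v := z) lim); rewrite -mulrA -expr2.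
move: sa; rewrite -mulrA starM starK => sa.
have paz : a ^+ 2 * z * (a * z) = a ^+ 2 * z by rewrite -mulrA (mulrA z) zaz.
have pE : a ^+ 2 * z = a * (a * z) by rewrite expr2 mulrA.
apply/eqP; rewrite mulrBr subr_eq0; apply/eqP.
by rewrite [X in _ = _ * X]pE [RHS]mulrA sa -[RHS]mulrA paz.
Qed.

(** Absorption puts w in the right ideal generated by p, to which a - p is
    orthogonal. *)
Lemma core_split_range a p z w v : core_quasinilpotent_split a p z ->
  w = a * w * v -> star (a - p) * w = 0.
Proof.
move=> S wE; have [_ _ lim] := core_split_gg_inverse S.
have [[pz2 _ _] py _ _] := S.
by rewrite -(absorption lim wE) -pz2 !mulrA star_mul_eq0 ?mul0r.
Qed.

(** The difference of the two cores p and q is also (a - q) - (a - p), and both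
    remainders are orthogonal to both cores: the difference is orthogonal to
    itself. *)
Lemma gg_inverse_uniq a x z : proper_involution A ->
  is_gg_inverse a x -> is_gg_inverse a z -> x = z.
Proof.
move=> proper gx gz.
have Sx := gg_inverse_core_split gx; have Sz := gg_inverse_core_split gz.
have range t : is_gg_inverse a t -> a ^+ 2 * t = a * (a ^+ 2 * t) * t.
  by move=> [tE _ _]; rewrite {1}tE [t ^+ 2]expr2 !mulrA -!exprSr.
have pq : a ^+ 2 * x = a ^+ 2 * z.
  apply/eqP; rewrite -subr_eq0; apply/eqP/proper.
  have {1}-> : a ^+ 2 * x - a ^+ 2 * z = (a - a ^+ 2 * z) - (a - a ^+ 2 * x).
    by rewrite opprB [RHS]addrC addrA subrK.
  rewrite starB mulrBl !mulrBr.
  rewrite (core_split_range Sx (range _ gx)) (core_split_range Sx (range _ gz)).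
  rewrite (core_split_range Sz (range _ gx)) (core_split_range Sz (range _ gz)).
  by rewrite !subrr.
have [gpx _ _ _] := Sx; have [gpz _ _ _] := Sz.
by rewrite pq in gpx; apply: group_inverse_uniq gpx gpz.
Qed.

End GeneralizedGroupInverse.

(** * Characterizations of generalized (b,c)-EP inverses *)

Theorem theorem2p1 (R : realType) (A : banachStarAlgType R[i])
    (hproper : proper_involution A) (a b c : A) :
  [<->
    (* (1) *)
    has_generalized_bc_EP_inverse b c a;
    (* (2) *)
    exists x y : A,
      [/\ a = x + y, star x * y = 0 /\ y * x = 0, bc_EP b c x
        & quasinilpotent y];
    (* (3) *)
    exists x : A,
      [/\ bc_EP b c x, x = a * x ^+ 2,
          star (star a * a ^+ 2 * x) = star a * a ^+ 2 * x
        & norm_root_cvg0 (fun n => a ^+ n - x * a ^+ n.+1)];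
    (* (4) *)
    gdrazin_invertible a /\
    exists x : A,
      [/\ bc_EP b c x, x = a * x ^+ 2,
          star (gdrazin_inverse a) * a ^+ 2 * x = star (gdrazin_inverse a) * a
        & norm_root_cvg0 (fun n => a ^+ n - x * a ^+ n.+1)] ].
Proof.
split.
  move=> [/(xgetPex 0) gz /(xgetPex 0) bz E].
  move: gz bz; rewrite -/(gg_inverse a) -/(bc_inverse b c a) -E.
  move: (gg_inverse a) => z gz bz.
  have S := gg_inverse_core_split gz; have [gp py yp qy] := S.
  exists (a ^+ 2 * z), (a - a ^+ 2 * z);
    split=> //; first by rewrite addrC subrK.
  apply/bc_EPP; exists z; split=> //.
  by apply: (bc_inverse_core b c gp (core_split_mulr S)).1.
split.
  move=> [p [y [aE [py yp] /bc_EPP[z [gp bp]] qy]]].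
  have yE : y = a - p by rewrite aE addrC addKr.
  rewrite yE in py yp qy.
  have [zE sa lim] : is_gg_inverse a z.
    by apply: (@core_split_gg_inverse _ _ a p).
  exists z; split=> //; apply/bc_EPP; exists p.
  by split; [exact: group_inverse_sym | exact: bc_inverse_sym].
split.
  move=> [x [bx xE sa lim]].
  have S : core_quasinilpotent_split a (a ^+ 2 * x) x.
    by apply: gg_inverse_core_split.
  have da : gdrazin_invertible a.
    by case: S => gp _ yp qy; apply: gdrazin_of_core gp yp qy.
  split=> //.
  exists x; split=> //.
  have [dE _] := gdrazin_limit (xgetPex 0 da).
  rewrite -/(gdrazin_inverse a) expr2 mulrA in dE.
  (* d = a d d lies in the range of the core, to which the remainder is
     orthogonal. *)
  have := star_mul_eq0 (core_split_range S dE).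
  by move=> /eqP; rewrite mulrBr subr_eq0 mulrA => /eqP.
move=> [/(xgetPex 0) ga [x [/bc_EPP[g [gx bx]] xE dx lim]]].
have [_ dlim] := gdrazin_limit ga; rewrite -/(gdrazin_inverse a) in ga dlim.
have [gp _ _] := limit_split xE lim.
have gE : g = a ^+ 2 * x := group_inverse_uniq gx (group_inverse_sym gp).
(* Conversely the core lies in the range of d. *)
have pd : gdrazin_inverse a * a * (a ^+ 2 * x) = a ^+ 2 * x.
  apply: (absorption (v := x) dlim).
  by rewrite {1}xE [x ^+ 2]expr2 !mulrA -!exprSr.
have py : star (a ^+ 2 * x) * (a - a ^+ 2 * x) = 0.
  have dy : star (gdrazin_inverse a) * (a - a ^+ 2 * x) = 0.
    by rewrite mulrBr mulrA dx subrr.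
  apply: star_mul_eq0.
  by rewrite -[X in _ * X]pd !mulrA (star_mul_eq0 dy) !mul0r.
have gg : is_gg_inverse a x by split=> //; rewrite -mulrA selfadjoint_core.
(* x is the (b,c)-inverse of its group inverse a ^+ 2 * x, hence of a. *)
have bax : is_bc_inverse b c a x.
  apply: (bc_inverse_core b c gp _).2.
    by rewrite {1}xE -[RHS]mulrA -expr2 expr2 !mulrA.
  by apply: bc_inverse_sym => //; rewrite -gE.
split; [by exists x | by exists x|].
rewrite (bc_inverseE bax); apply: xget_unique => // y gy.
exact: gg_inverse_uniq gy gg.
Qed.
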